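(* Let $k\ge 2$ be an integer and let $G$ be an oriented graph with $\delta^0(G)\ge 3k/4$. Then $G$ contains as a subgraph every $k$-arc oriented path with two blocks.
   Context: An oriented graph is a digraph with no directed cycles of length one or two (no loops, at most one arc between any two distinct vertices, in at most one direction). Digraphs are finite with nonempty vertex set. The minimum semidegree $\delta^0(G)$ is the minimum value among the in-degrees and out-degrees of all vertices of $G$. An oriented path is an orientation of an undirected path (all vertices distinct). A directed path is an oriented path in which all arcs have the same direction. A block of an oriented path is a maximal directed subpath, and its size is the number of its arcs. Thus a $k$-arc oriented path with two blocks is a path on distinct vertices $p_0,p_1,\dots,p_k$ for which there is an integer $r$ with $1\le r\le k-1$ such that either the arcs are $(p_{i+1},p_i)$ for $0\le i<r$ and $(p_i,p_{i+1})$ for $r\le i<k$, or the arcs are $(p_i,p_{i+1})$ for $0\le i<r$ and $(p_{i+1},p_i)$ for $r\le i<k$. $G$ contains an oriented path $P$ (as a not necessarily induced subgraph) if there is an injective map $f:V(P)\to V(G)$ such that $(f(u),f(v))$ is an arc of $G$ for every arc $(u,v)$ of $P$. *)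

(* Defs.v *)
From HB Require Import structures.
From mathcomp Require Import all_boot all_order all_algebra.

Set Implicit Arguments.
Unset Strict Implicit.
Unset Printing Implicit Defensive.

Record digraph := Digraph {
  vertex :> finType;
  arc : rel vertex;
  vertex_gt0 : 0 < #|vertex|
}.

Definition oriented_graph (G : digraph) : Prop :=
  (forall u : G, ~~ arc u u) /\ (forall u v : G, ~~ (arc u v && arc v u)).

Definition outdeg (G : digraph) (v : G) : nat := #|[set w : G | arc v w]|.
Definition indeg (G : digraph) (v : G) : nat := #|[set w : G | arc w v]|.

(* Every degree is at most #|G| and G is nonempty, so the default value #|G|
   does not affect the minimum. *)
Definition min_semidegree (G : digraph) : nat :=
  \big[minn/#|G|]_(v : G) minn (indeg v) (outdeg v).

(* The arcs of P are exactly the listed ones and p enumerates all of its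
   vertices, so P is the path itself and not a digraph containing it.  The
   disjuncts [i.+1 == j] and [j.+1 == i] are the forward arcs (p_i, p_(i+1))
   and the backward arcs (p_(j+1), p_j).  The blocks are p_0 ... p_r and
   p_r ... p_k. *)
Definition two_block_path (k : nat) (P : digraph) : Prop :=
  exists (p : 'I_k.+1 -> P) (r : nat),
    [/\ bijective p,
        1 <= r <= k - 1
      & (forall i j : 'I_k.+1,
           arc (p i) (p j) =
             ((j.+1 == i) && (j < r)) || ((i.+1 == j) && (r <= i)))
        \/
        (forall i j : 'I_k.+1,
           arc (p i) (p j) =
             ((i.+1 == j) && (i < r)) || ((j.+1 == i) && (r <= j)))].

Definition contains (G P : digraph) : Prop :=
  exists f : P -> G,
    injective f /\ (forall u v : P, arc u v -> arc (f u) (f v)).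

(* Main.v *)
Require Import Defs.
From HB Require Import structures.
From mathcomp Require Import all_boot all_order all_algebra.
From mathcomp Require Import zify.

Set Implicit Arguments.
Unset Strict Implicit.

(** Let [d] be the minimum semidegree and let the blocks have sizes [a] and
    [b], so that [3 (a + b) <= 4 d].  Reversing all arcs if necessary, the
    common end of the two blocks is a source.  So the task is to find a
    spider: a vertex with two directed paths of lengths [a] and [b] that leave
    it and share nothing else.  By symmetry [a <= b], hence [a <= 2 d / 3].

    Take a longest directed path [u_0 ... u_l] and, among all the longest
    ones, one with an arc [u_i -> u_0] for which [i] is as large as possible.
    Maximality of the length puts every in-neighbour of [u_0] and every
    out-neighbour of [u_l] on the path.  The path is a cycle [u_0 ... u_i] of
    [i + 1] vertices followed by a tail of [l - i] vertices.

    The path is long: [2 d <= l] ([double_degree_le_longest], a theorem of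
    Jackson).  If the tail is empty, the [2 d] neighbours of [u_0] all lie
    among [u_1, ..., u_l].  Otherwise each out-neighbour [u_q] of [u_l] on the
    cycle yields another longest path, which starts at [u_(i+1)] and follows
    the tail, then the cycle from [u_q] around to [u_(q-1)].  As its closing
    arc cannot beat [i], the [l - i] vertices that precede [u_q] on the cycle
    are not in-neighbours of [u_(i+1)].  Counting the [d] in-neighbours of
    [u_(i+1)] among the remaining vertices gives the bound.

    An in-neighbour [u_j] of [u_0] is the centre of a spider with branches of
    lengths [j] and [l - j] ([spider_in_head]).  When no such spider is good
    enough, the [d] in-neighbours of [u_0] all have index below [a] or above
    [l - a].  This forces the tail to have fewer than [2 a - d] vertices and
    the cycle to have at least [5 a / 2].

    If the tail is nonempty, more than [a] of the [d] out-neighbours of [u_l]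
    lie on this cycle.  So two of them are at distance at least [a] both ways
    around it ([exists_far_pair]); they cut the cycle into two branches of a
    spider centred at [u_l] ([spider_lollipop]).  If the tail is empty, the
    out-neighbours of [u_0] are on the path as well, and without a spider
    centred at [u_0] ([spider_out_head]) all [2 d] neighbours of [u_0] have
    index at most [a] or above [l - a], which is impossible because
    [a < d]. *)

(** * Lists of natural numbers *)

Section Lists.

Lemma uniq_catI (T : eqType) (s t : seq T) :
  uniq s -> uniq t -> (forall x, x \in s -> x \in t -> False) ->
  uniq (s ++ t).
Proof.
move=> us ut dis; rewrite cat_uniq us ut andbT /=.
by apply/hasPn => x xt; apply/negP => xs; exact: dis xs xt.
Qed.

Lemma size_sub_iota (s : seq nat) (m n : nat) :
  uniq s -> (forall x, x \in s -> m <= x < m + n) -> size s <= n.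
Proof.
move=> us sub; rewrite -(size_iota m n); apply: uniq_leq_size => // x xs.
by rewrite mem_iota sub.
Qed.

Lemma min_mem (s : seq nat) :
  0 < size s -> exists2 m, m \in s & forall x, x \in s -> m <= x.
Proof.
elim: s => // y s IH _; case: s IH => [|z s] IH.
  by exists y; rewrite ?mem_head // => x; rewrite inE => /eqP->.
case: (IH isT) => m ms hm; case: (leqP y m) => h.
  exists y; rewrite ?mem_head // => x; rewrite inE => /orP[/eqP->//|/hm].
  exact: leq_trans.
exists m; first by rewrite inE ms orbT.
by move=> x; rewrite inE => /orP[/eqP->|/hm//]; exact: ltnW.
Qed.

(** On a cycle of length [L >= 5 a / 2], more than [a] points cannot be
    pairwise at cyclic distance less than [a].  Suppose they were, and let [q0]
    be the least one.  The others are within [a] of [q0], on its right or, for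
    those above [q0 + L - a], on its left; let [y] be the first one met on the
    left when going around from [q0] (if there is none, a window of length [a]
    from [q0] contains all points).  If every point on the right is close to
    [y] across [q0], then all points lie in the window of length [a] that
    starts at [y].  Otherwise some [x] on the right is close to [y] the other
    way around; closeness to [y] and to [x] then confines all points to four
    intervals, whose lengths add up to at most [6 a - 2 L <= a]. *)
Lemma exists_far_pair (a L : nat) (Q : seq nat) :
  uniq Q -> (forall q, q \in Q -> q < L) -> a < size Q -> 5 * a <= 2 * L ->
  exists q q', [/\ q \in Q, q' \in Q, q + a <= q' & q' + a <= q + L].
Proof.
move=> uQ QL sQ aL.
have [/hasP[q qQ /hasP[q' q'Q /andP[h1 h2]]]|/hasPn far] := boolP
  (has (fun q => has (fun q' => (q + a <= q') && (q' + a <= q + L)) Q) Q).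
  by exists q, q'.
have {}far x y : x \in Q -> y \in Q -> x + a <= y -> x + L < y + a.
  move=> xQ yQ hxy; move/hasPn: (far x xQ) => /(_ y yQ).
  by rewrite hxy /= -ltnNge.
exfalso.
have [q0 q0Q q0min] : exists2 m, m \in Q & forall x, x \in Q -> m <= x.
  by apply: min_mem; apply: leq_trans sQ.
have [b0|] := posnP (size [seq x <- Q | q0 + a <= x]).
  suff: size Q <= a by rewrite leqNgt sQ.
  apply: (@size_sub_iota _ q0) => // x xQ; rewrite q0min //=.
  rewrite ltnNge; apply/negP => hx.
  move/size0nil: b0 => /eqP; apply/negP; rewrite -has_filter.
  by apply/hasP; exists x.
case/min_mem=> y; rewrite mem_filter => /andP[hy yQ] ymin.
have {}ymin x : x \in Q -> q0 + a <= x -> y <= x.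
  by move=> xQ hx; apply: ymin; rewrite mem_filter hx.
have fy := far _ _ q0Q yQ hy; have yL := QL _ yQ.
have [/hasP[x xQ /andP[hx1 hx2]]|/hasPn no] :=
  boolP (has (fun x => (x < q0 + a) && (y < x + a)) Q); last first.
  suff: size Q <= size (iota q0 (y + a - L - q0) ++ iota y (L - y)).
    rewrite size_cat !size_iota; clear - sQ fy yL aL; lia.
  apply: uniq_leq_size => // z zQ; rewrite mem_cat !mem_iota.
  have [hz|hz] := leqP (q0 + a) z.
    by have := ymin z zQ hz; have := QL z zQ; clear; lia.
  have := no z zQ; rewrite hz /= -leqNgt => /(far _ _ zQ yQ).
  by have := q0min z zQ; clear; lia.
suff: size Q <= size (iota (y - a).+1 (q0 + 2 * a - 1 - y)
     ++ iota q0 (y + a - L - q0)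
     ++ iota (q0 + L - a).+1 (x + 2 * a - 1 - q0 - L)
     ++ iota (x + L - a).+1 (a - 1 - x)).
  rewrite !size_cat !size_iota; have := q0min x xQ.
  by clear - sQ aL hx1 hx2 fy yL hy; lia.
apply: uniq_leq_size => // z zQ; rewrite !mem_cat !mem_iota.
have := q0min z zQ; have := QL z zQ.
have [hz|hz] := leqP (q0 + a) z.
  have := far _ _ q0Q zQ hz; have [hxz|hxz] := leqP (x + a) z.
    by have := far _ _ xQ zQ hxz => h1 h2 h3 h4; apply/or4P/Or44; lia.
  by move=> h1 h2 h3; apply/or4P/Or43; lia.
have [hzy|hzy] := leqP (z + a) y.
  by have := far _ _ zQ yQ hzy => h1 h2 h3; apply/or4P/Or42; lia.
by move=> h1 h2; apply/or4P/Or41; lia.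
Qed.

End Lists.

(** * Spiders *)

Definition spider (V : finType) (e : rel V) (a b : nat) : Prop :=
  exists (x : V) (A B : seq V),
    [/\ path e x A, path e x B, uniq (x :: A ++ B), size A = a & size B = b].

Lemma spider_sym (V : finType) (e : rel V) (a b : nat) :
  spider e a b -> spider e b a.
Proof.
case=> x [A [B [pA pB u sA sB]]]; exists x, B, A; split=> //.
by move: u; rewrite /= !mem_cat uniq_catC orbC.
Qed.

Lemma spider_trim (V : finType) (e : rel V) (a b : nat) (x : V) (A B : seq V) :
  path e x A -> path e x B -> uniq (x :: A ++ B) ->
  a <= size A -> b <= size B -> spider e a b.
Proof.
move=> pA pB u aA bB; exists x, (take a A), (take b B); split.
- exact: take_path.
- exact: take_path.
- apply: subseq_uniq u; rewrite -cat1s -[x :: A ++ B]cat1s.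
  by apply: cat_subseq => //; apply: cat_subseq; exact: take_subseq.
- exact: size_takel.
- exact: size_takel.
Qed.

(** * Longest directed paths *)

Section LongestPaths.

Variables (V : finType) (e : rel V) (x0 : V).

Definition dipath (s : seq V) : bool := sorted e s && uniq s.

Definition longest (s : seq V) : Prop :=
  dipath s /\ forall s', dipath s' -> size s' <= size s.

Definition closes (s : seq V) (j : nat) : bool :=
  (j < size s) && e (nth x0 s j) (nth x0 s 0).

Lemma longest_exists : exists s, longest s.
Proof.
pose P n := [exists t : n.-tuple V, dipath t].
have P0 : exists n, P n by exists 0; apply/existsP; exists [tuple].
have PV n : P n -> n <= #|V|.
  case/existsP=> t /andP[_ /card_uniqP ut].
  by rewrite -(size_tuple t) -ut; apply: max_card.
case: (ex_maxnP P0 PV) => n /existsP[t dt] maxn; exists t; split=> // s' ds'.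
rewrite size_tuple; apply: maxn; apply/existsP; exists (in_tuple s').
exact: ds'.
Qed.

Lemma longest_in (s : seq V) (w : V) :
  longest s -> 0 < size s -> e w (nth x0 s 0) -> w \in s.
Proof.
case: s => //= y s [/andP[/= ps us] maxs] _ ewy; apply: contraT => ws.
have := maxs (w :: y :: s); rewrite /dipath /= ewy ps ws us /=.
by move/(_ isT); rewrite ltnn.
Qed.

Lemma longest_out (s : seq V) (w : V) :
  longest s -> 0 < size s -> e (nth x0 s (size s).-1) w -> w \in s.
Proof.
rewrite nth_last; case: s => //= y s [/andP[/= ps us] maxs] _ ewy.
apply: contraT => ws.
have := maxs (rcons (y :: s) w).
rewrite /dipath rcons_uniq ws /= us rcons_path ps ewy.
by move/(_ isT); rewrite size_rcons ltnn.
Qed.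

(** An in-neighbour of the first vertex of a longest path is on the path, so
    closing arcs exist.  The maximum is over all longest paths at once, because
    it will be compared with rotated paths. *)
Lemma longest_max_closing :
  (forall v, 0 < #|[set w | e w v]|) ->
  exists s i, [/\ longest s, closes s i
    & forall s' j, longest s' -> closes s' j -> j <= i].
Proof.
move=> indeg_gt0; have [s ls] := longest_exists.
have s_gt0 : 0 < size s by have [_ /(_ [:: x0])] := ls; apply.
pose n := size s.
have eqsz s' : longest s' -> size s' = n.
  move=> ls'; apply/eqP; rewrite eqn_leq /n.
  by case: ls ls' => ds ms [ds' ms']; rewrite ms' // ms.
pose P j := [exists t : n.-tuple V, dipath t && closes t j].
have P0 : exists j, P j.
  have /card_gt0P[w] := indeg_gt0 (nth x0 s 0); rewrite inE => ew.
  have ws := longest_in ls s_gt0 ew.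
  exists (index w s); apply/existsP; exists (in_tuple s).
  by rewrite /closes /= index_mem ws nth_index // ew (proj1 ls).
have PV j : P j -> j <= n.
  by case/existsP=> t /andP[_ /andP[]]; rewrite size_tuple => /ltnW.
case: (ex_maxnP P0 PV) => i /existsP[t /andP[dt ct]] maxi.
exists t, i; split=> //.
  by split=> // s' ds'; rewrite size_tuple; exact: (proj2 ls).
move=> s' j ls' cj; apply: maxi; apply/existsP.
have sz := eqsz _ ls'.
by exists (tcast sz (in_tuple s')); rewrite val_tcast /= cj (proj1 ls').
Qed.

(** * Walks along a longest path, as lists of indices *)

(** From here on, walks that rearrange a fixed longest path [p] are lists of
    positions in [p].  A segment of [p] is then an [iota], and disjointness of
    segments becomes linear arithmetic. *)
Section IndexLists.

Variables (p : seq V) (l : nat).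
Hypotheses (p_longest : longest p) (p_size : size p = l.+1).

Let u j := nth x0 p j.
Let E j j' := e (u j) (u j').

Lemma step j : j < l -> E j j.+1.
Proof.
case: p_longest => /andP[/(sortedP x0) h _] _ jl; apply: h.
by rewrite p_size ltnS.
Qed.

Lemma path_iota j m k :
  m + k <= l.+1 -> (0 < k -> E j m) -> path E j (iota m k).
Proof.
elim: k j m => //= k IH j m mk Ejm; rewrite Ejm //=.
by apply: IH => [|k0]; [lia | apply: step; lia].
Qed.

Lemma path_iota_cat j m k s :
  0 < k -> m + k <= l.+1 -> E j m -> path E (m + k).-1 s ->
  path E j (iota m k ++ s).
Proof.
move=> k0 mk Ejm ps; rewrite cat_path path_iota //=.
have -> // : last j (iota m k) = (m + k).-1.
by case: k k0 {mk ps} => // k _; rewrite -{1}addn1 iotaD last_cat /= addnS.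
Qed.

Lemma uniq_map_nth J :
  (forall j, j \in J -> j <= l) -> uniq J -> uniq (map u J).
Proof.
move=> Jl uJ; rewrite map_inj_in_uniq // => j j' /Jl hj /Jl hj' /eqP.
case: p_longest => /andP[_ up] _.
by rewrite nth_uniq ?p_size ?ltnS // => /eqP.
Qed.

Lemma spider_index j J K a b :
  path E j J -> path E j K -> uniq (j :: J ++ K) ->
  (forall h, h \in j :: J ++ K -> h <= l) ->
  a <= size J -> b <= size K -> spider e a b.
Proof.
move=> pJ pK uJK bd aJ bK.
apply: (@spider_trim _ _ _ _ (u j) (map u J) (map u K)).
- by rewrite path_map.
- by rewrite path_map.
- by rewrite -map_cat -map_cons; apply: uniq_map_nth.
- by rewrite size_map.
- by rewrite size_map.
Qed.

Lemma longest_reorder J :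
  sorted E J -> uniq J -> size J = l.+1 -> (forall j, j \in J -> j <= l) ->
  longest (map u J).
Proof.
move=> sJ uJ szJ bd; split.
  by rewrite /dipath uniq_map_nth // andbT sorted_map.
by move=> s' ds'; rewrite size_map szJ -p_size; exact: (proj2 p_longest).
Qed.

Definition indices (S : {set V}) : seq nat :=
  [seq j <- iota 0 l.+1 | u j \in S].

Lemma mem_indices S j : (j \in indices S) = (u j \in S) && (j <= l).
Proof. by rewrite mem_filter mem_iota. Qed.

Lemma indices_uniq S : uniq (indices S).
Proof. by rewrite filter_uniq // iota_uniq. Qed.

Lemma leq_card_indices (S : {set V}) :
  {subset S <= p} -> #|S| <= size (indices S).
Proof.
move=> Sp; rewrite cardE -(size_map u (indices S)).
apply: uniq_leq_size; first exact: enum_uniq.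
move=> v; rewrite mem_enum => vS; have vp := Sp v vS.
apply/mapP; exists (index v p); last by rewrite /u nth_index.
by rewrite mem_indices /u nth_index // vS -ltnS -p_size index_mem.
Qed.

Lemma uniq_iota_cat m1 k1 m2 k2 :
  (m1 + k1 <= m2) || (m2 + k2 <= m1) -> uniq (iota m1 k1 ++ iota m2 k2).
Proof.
move=> h; apply: uniq_catI; rewrite ?iota_uniq // => j.
by rewrite !mem_iota; lia.
Qed.

(** The branches are [u_0, ..., u_(j-1)], entered by the closing arc, and the
    rest of the path after [u_j]. *)
Lemma spider_in_head j a b :
  E j 0 -> j <= l -> a <= j -> b <= l - j -> spider e a b.
Proof.
move=> Ej0 jl aj bj; apply: (@spider_index j (iota 0 j) (iota j.+1 (l - j))).
- by apply: path_iota; lia.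
- by apply: path_iota => [|h]; [lia | apply: step; lia].
- rewrite cons_uniq uniq_iota_cat ?andbT; last by lia.
  by rewrite mem_cat !mem_iota; lia.
- by move=> h; rewrite inE mem_cat !mem_iota; lia.
- by rewrite size_iota.
- by rewrite size_iota.
Qed.

(** The arc [u_0 -> u_j] cuts the rest of the path into two branches:
    [u_1, ..., u_(j-1)] and [u_j, ..., u_l]. *)
Lemma spider_out_head j a b :
  E 0 j -> 0 < j <= l -> a <= j - 1 -> b <= l.+1 - j -> spider e a b.
Proof.
move=> E0j jl aj bj.
apply: (@spider_index 0 (iota 1 (j - 1)) (iota j (l.+1 - j))).
- by apply: path_iota => [|h]; [lia | apply: step; lia].
- by apply: path_iota => [|h]; [lia | done].
- rewrite cons_uniq uniq_iota_cat ?andbT; last by lia.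
  by rewrite mem_cat !mem_iota; lia.
- by move=> h; rewrite inE mem_cat !mem_iota; lia.
- by rewrite size_iota.
- by rewrite size_iota.
Qed.

(** Two out-neighbours of the end of the tail cut the cycle [u_0, ..., u_i]
    into two arcs, each of which is a branch; the second one passes through
    the closing arc [u_i -> u_0]. *)
Lemma spider_lollipop i q q' a b :
  E i 0 -> i < l -> E l q -> E l q' -> q <= q' <= i ->
  a <= q' - q -> b <= q + i.+1 - q' -> spider e a b.
Proof.
move=> Ei0 il Elq Elq' qi aq bq.
apply: (@spider_index l (iota q (q' - q)) (iota q' (i.+1 - q') ++ iota 0 q)).
- by apply: path_iota => [|_ //]; lia.
- apply: path_iota_cat => //; [lia | lia |].
  have -> : (q' + (i.+1 - q')).-1 = i by lia.
  by apply: path_iota => [|_ //]; lia.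
- rewrite cons_uniq; apply/andP; split.
    by rewrite !mem_cat !mem_iota; lia.
  apply: uniq_catI; rewrite ?iota_uniq ?uniq_iota_cat //; first by lia.
  by move=> x; rewrite mem_cat !mem_iota; lia.
- by move=> h; rewrite inE !mem_cat !mem_iota; lia.
- by rewrite size_iota.
- by rewrite size_cat !size_iota; lia.
Qed.

(** The rotated path runs along the tail, jumps from its end [u_l] to [u_q]
    and goes once around the cycle. *)
Lemma longest_rotate i q :
  E i 0 -> i < l -> E l q -> q <= i ->
  longest (map u (iota i.+1 (l - i) ++ iota q (i.+1 - q) ++ iota 0 q)).
Proof.
move=> Ei0 il Elq qi; apply: longest_reorder.
- have -> : l - i = (l - i.+1).+1 by lia.
  have tail : path E l (iota q (i.+1 - q) ++ iota 0 q).
    apply: path_iota_cat => //; [lia | lia |].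
    have -> : (q + (i.+1 - q)).-1 = i by lia.
    by apply: path_iota => [|_ //]; lia.
  rewrite /=; have [le|lt] := leqP l i.+1.
    have eql : l = i.+1 by apply/eqP; rewrite eqn_leq le il.
    by move: tail; rewrite eql subnn.
  apply: path_iota_cat; [lia | lia | apply: step; lia |].
  by have -> : (i.+2 + (l - i.+1)).-1 = l by lia.
- apply: uniq_catI; rewrite ?iota_uniq ?uniq_iota_cat //; first by lia.
  by move=> x; rewrite mem_cat !mem_iota; lia.
- by rewrite !size_cat !size_iota; lia.
- by move=> j; rewrite !mem_cat !mem_iota; lia.
Qed.

(** If the whole path closes into a cycle, it can be cut open so as to end
    at [u_0]; maximality then keeps the out-neighbours of [u_0] inside. *)
Lemma longest_cycle_out w :
  E l 0 -> e (u 0) w -> w \in p.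
Proof.
move=> El0 e0w; rewrite -[w \in p]negbK; apply/negP => wp.
pose s := map u (iota 1 l ++ [:: 0]).
have ls : longest s.
  apply: longest_reorder.
  - have [l0|l_gt0] := posnP l; first by rewrite l0.
    have -> : l = (l - 1).+1 by lia.
    rewrite /=; have [le|lt] := leqP l 1.
      have eql : l = 1 by lia.
      by rewrite eql /= -[X in E X _]eql El0.
    apply: path_iota_cat; [lia | lia | apply: step; lia |].
    have -> : (2 + (l - 1)).-1 = l by lia.
    by rewrite /= El0.
  - by apply: (@uniq_iota_cat 1 l 0 1); lia.
  - by rewrite size_cat size_iota /= addn1.
  - by move=> j; rewrite mem_cat mem_iota inE; lia.
have szs : size s = l.+1 by rewrite size_map size_cat size_iota /= addn1.
have : w \in s.
  apply: longest_out ls _ _; first by rewrite szs.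
  rewrite szs /= /s (nth_map 0) ?nth_cat ?size_cat size_iota ?ltnn ?subnn //=.
  by rewrite addn1.
case/mapP=> j; rewrite mem_cat mem_iota inE => hj wE.
by move/negP: wp; apply; rewrite wE mem_nth // p_size; lia.
Qed.

(** * Counting neighbours by their indices *)

Section Degrees.

Variables (d i : nat).
Hypotheses (e_asym : forall x y, e x y -> ~~ e y x)
  (outdeg_ge : forall v, d <= #|[set w | e v w]|)
  (indeg_ge : forall v, d <= #|[set w | e w v]|).
Hypotheses (p_closes : closes p i)
  (i_max : forall s j, longest s -> closes s j -> j <= i).

Let ins j := indices [set w | e w (u j)].
Let outs j := indices [set w | e (u j) w].

Lemma mem_ins j h : (h \in ins j) = E h j && (h <= l).
Proof. by rewrite mem_indices inE. Qed.

Lemma mem_outs j h : (h \in outs j) = E j h && (h <= l).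
Proof. by rewrite mem_indices inE. Qed.

Lemma E_irr j : ~~ E j j.
Proof. by apply/negP => h; move/negP: (e_asym h); apply. Qed.

Lemma size_ins0 : d <= size (ins 0).
Proof.
apply: leq_trans (indeg_ge _) (leq_card_indices _) => w; rewrite inE.
by apply: longest_in => //; rewrite p_size.
Qed.

Lemma size_outsl : d <= size (outs l).
Proof.
apply: leq_trans (outdeg_ge _) (leq_card_indices _) => w; rewrite inE => h.
by apply: (longest_out p_longest); rewrite p_size.
Qed.

Lemma i_le : i <= l.
Proof. by move: p_closes => /andP[]; rewrite p_size ltnS. Qed.

Lemma Ei0 : E i 0.
Proof. by move: p_closes => /andP[]. Qed.

Lemma size_outs0 : i = l -> d <= size (outs 0).
Proof.
move=> il; apply: leq_trans (outdeg_ge _) (leq_card_indices _) => w.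
by rewrite inE => h; apply: longest_cycle_out => //; rewrite -{1}il Ei0.
Qed.

Lemma uniq_ins_outs j : uniq (ins j ++ outs j).
Proof.
apply: uniq_catI; rewrite ?indices_uniq // => h.
by rewrite mem_ins mem_outs => /andP[/e_asym/negP hj _] /andP[].
Qed.

(** An out-neighbour of [u_l] in the tail is one of its [l - i - 1] vertices
    other than [u_l]. *)
Lemma size_outsl_cycle :
  i < l -> d <= size [seq q <- outs l | q <= i] + (l - i - 1).
Proof.
move=> il; apply: leq_trans size_outsl _.
rewrite -(count_predC (fun q => q <= i)) -!size_filter leq_add2l.
apply: (@size_sub_iota _ i.+1); first by rewrite !filter_uniq // iota_uniq.
move=> q; rewrite mem_filter mem_outs /= -ltnNge => /and3P[iq Elq ql].
rewrite iq /=; have : q != l by apply: contraTneq Elq => ->; apply: E_irr.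
by move: ql il iq; clear; lia.
Qed.

(** The left-hand side is the position of [u_w] in the path rotated at [q]:
    the arc [u_w -> u_(i+1)] closes that path, hence is subject to the
    maximality of [i]. *)
Lemma rotate_closing q w :
  i < l -> E l q -> q <= i -> E w i.+1 -> w <= i ->
  (if q <= w then l - i + (w - q) else l - i + (i.+1 - q) + w) <= i.
Proof.
move=> il Elq qi Ewi wi; apply: i_max (longest_rotate Ei0 il Elq qi) _.
set J := _ ++ _; have szJ : size J = l.+1.
  by rewrite !size_cat !size_iota; lia.
rewrite /closes size_map szJ !(nth_map 0) ?szJ //; last by case: ifP; lia.
rewrite {2}/J; have -> : l - i = (l - i.+1).+1 by lia.
rewrite /=; have -> : (l - i.+1).+1 = l - i by lia.
rewrite (_ : nth 0 J _ = w).
  by apply/andP; split; [case: ifP; lia | exact: Ewi].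
rewrite /J !nth_cat !size_iota; have [h|h] := leqP q w.
  rewrite ltnNge leq_addr /= addKn.
  have -> : w - q < i.+1 - q by lia.
  by rewrite nth_iota; lia.
rewrite -addnA ltnNge leq_addr /= addKn ltnNge leq_addr /= addKn.
by rewrite nth_iota; lia.
Qed.

(** When the tail is nonempty, [rotate_closing] excludes the [l - i] vertices
    before each out-neighbour of [u_l] on the cycle from the in-neighbours of
    [u_(i+1)].  It is enough to exclude all of them for the first such
    out-neighbour [q0], and only the immediate predecessor for the others;
    these excluded vertices form [W].  As [u_i -> u_(i+1)] is itself an arc,
    they do not wrap around: [l - i <= q0]. *)
Lemma double_degree_le_longest : 2 * d <= l.
Proof.
have [il|il] := leqP l i.
  have eil : i = l by apply/eqP; rewrite eqn_leq i_le.
  apply: leq_trans (_ : size (ins 0 ++ outs 0) <= l).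
    by rewrite size_cat; have := size_ins0; have := size_outs0 eil; lia.
  apply: (@size_sub_iota _ 1) (uniq_ins_outs 0) _ => j.
  rewrite mem_cat mem_ins mem_outs add1n ltnS => h.
  have -> : j <= l by case/orP: h => /andP[].
  rewrite andbT lt0n; apply: contraTneq h => ->.
  by rewrite (negbTE (E_irr 0)).
pose Q := [seq q <- outs l | q <= i].
have QP q : q \in Q -> E l q /\ q <= i.
  by rewrite mem_filter mem_outs => /and3P[].
have sQ := size_outsl_cycle il; rewrite -/Q in sQ.
have [Q0|Q_gt0] := posnP (size Q).
  (* Cycle and tail then have more than [d] vertices each. *)
  have : size (ins 0) <= i.
    apply: (@size_sub_iota _ 1); first exact: indices_uniq.
    move=> j; rewrite mem_ins add1n ltnS => /andP[Ej0 jl]; apply/andP; split.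
      by rewrite lt0n; apply: contraTneq Ej0 => ->; apply: E_irr.
    by apply: i_max p_longest _; rewrite /closes p_size ltnS jl.
  by have := size_ins0; clear - Q0 sQ il; lia.
have [q0 q0Q q0min] := min_mem Q_gt0; have [Elq0 q0i] := QP _ q0Q.
have sins : d <= size (ins i.+1).
  apply: leq_trans (indeg_ge _) (leq_card_indices _) => w; rewrite inE => h.
  have lr := longest_rotate Ei0 il Elq0 q0i.
  have : w \in map u (iota i.+1 (l - i) ++ iota q0 (i.+1 - q0) ++ iota 0 q0).
    apply: (longest_in lr).
      by rewrite size_map !size_cat !size_iota; lia.
    by have -> : l - i = (l - i.+1).+1 by lia.
  case/mapP=> j; rewrite !mem_cat !mem_iota => hj ->.
  by apply: mem_nth; rewrite p_size; lia.
(* The path arc from [u_i] to [u_(i+1)] closes the rotation at [q0]. *)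
have tq0 : l - i <= q0.
  have := rotate_closing il Elq0 q0i (step il) (leqnn i).
  by rewrite q0i; lia.
pose W := iota (q0 - (l - i)) (l - i - 1) ++ map predn Q.
have QW q : q \in Q -> 0 < q by move/q0min; lia.
have Wi h : h \in W -> h <= i.
  rewrite mem_cat mem_iota => /orP[|/mapP[q qQ ->]]; first by lia.
  by have [_] := QP _ qQ; lia.
have uW : uniq W.
  apply: uniq_catI; first exact: iota_uniq.
    rewrite map_inj_in_uniq; last by move=> q q' /QW qQ /QW q'Q /=; lia.
    by rewrite !filter_uniq // iota_uniq.
  move=> h; rewrite mem_iota => h1 /mapP[q qQ hE].
  by move: (q0min _ qQ) h1; rewrite hE; clear - tq0 il; lia.
have insW : uniq (i.+1 :: ins i.+1 ++ W).
  rewrite cons_uniq mem_cat mem_ins (negbTE (E_irr _)) /=; apply/andP; split.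
    by apply/negP => /Wi; rewrite ltnn.
  apply: uniq_catI => //; first exact: indices_uniq.
  move=> w; rewrite mem_ins => /andP[Ewi wl] wW; have wi := Wi _ wW.
  have clo q : q \in Q -> w < q -> w + (l - i) < q.
    move=> qQ wq; have [Elq qi] := QP _ qQ.
    have := rotate_closing il Elq qi Ewi wi; rewrite (leqNgt q w) wq /=.
    by clear - qi il; lia.
  move: wW; rewrite mem_cat mem_iota => /orP[h|/mapP[q qQ wE]].
    by have := clo _ q0Q; lia.
  by have := clo _ qQ; have := QW _ qQ; lia.
have : size (i.+1 :: ins i.+1 ++ W) <= l.+1.
  apply: (@size_sub_iota _ 0) => // j; rewrite inE mem_cat mem_ins add0n ltnS.
  by case/or3P=> [/eqP->//|/andP[]//|/Wi ji]; apply: leq_trans ji (ltnW il).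
by rewrite /= !size_cat size_iota size_map; lia.
Qed.

(** If no in-neighbour of [u_0] is a suitable centre, their indices are pushed
    to both ends of the path.  Room for [d] of them then remains only if the
    tail is short, and so [u_l] (or [u_0], if there is no tail) has too many
    neighbours on a long cycle to avoid being a centre itself. *)
Lemma spider_of_closing a b :
  0 < a -> a <= b -> 3 * (a + b) <= 4 * d -> spider e a b.
Proof.
move=> a_gt0 ab abd; have ld := double_degree_le_longest; have il := i_le.
have [/hasP[j]|/hasPn no_in] := boolP (has (fun j =>
    (a <= j) && (b <= l - j) || (b <= j) && (a <= l - j)) (ins 0)).
  rewrite mem_ins => /andP[Ej0 jl] /orP[]/andP[h1 h2].
    exact: spider_in_head Ej0 jl h1 h2.
  by apply: spider_sym; exact: spider_in_head Ej0 jl h1 h2.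
have insP j : j \in ins 0 -> 0 < j <= i.
  rewrite mem_ins => /andP[Ej0 jl]; apply/andP; split.
    by rewrite lt0n; apply: contraTneq Ej0 => ->; apply: E_irr.
  by apply: i_max p_longest _; rewrite /closes p_size ltnS jl.
(* The middle interval is empty unless [l + 1 < 2 * b]. *)
have : size (ins 0) <= size (iota 1 (a - 1)
    ++ iota (l - b).+1 (2 * b - l - 1) ++ iota (l - a).+1 (a - (l - i))).
  apply: uniq_leq_size; first exact: indices_uniq.
  move=> j jin; rewrite !mem_cat !mem_iota; have := insP _ jin.
  have [ja|aj] := ltnP j a.
    by move=> h; apply/or3P/Or31; lia.
  have := no_in _ jin; rewrite aj /= negb_or !negb_and -!ltnNge.
  have [bj|jb] := leqP b j => h1 h2.
    by apply/or3P/Or33; lia.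
  by apply/or3P/Or32; lia.
rewrite !size_cat !size_iota; have := size_ins0 => ins_d ins_le.
(* [2 * d <= l] rules out a nonempty middle interval: together with it the
   three intervals hold at most [2 * (a + b) - l - 2 < d] indices. *)
have {ins_d ins_le} [bl tail_le] : 2 * b <= l.+1 /\ l - i + d < 2 * a.
  by clear - a_gt0 ab abd ld il ins_d ins_le; lia.
have [lti|lei] := ltnP i l; last first.
  have eil : i = l by apply/eqP; rewrite eqn_leq il.
  have [/hasP[j]|/hasPn no_out] := boolP (has (fun j =>
      (a < j) && (j + a <= l.+1)) (outs 0)).
    rewrite mem_outs => /andP[E0j jl] /andP[h1 h2].
    have [jb|bj] := leqP j b.
      by apply: (spider_out_head E0j); lia.
    by apply: spider_sym; apply: (spider_out_head E0j); lia.
  have : size (ins 0 ++ outs 0) <= size (iota 1 a ++ iota (l - a).+1 a).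
    apply: uniq_leq_size; first exact: uniq_ins_outs.
    move=> j; rewrite !mem_cat !mem_iota => /orP[jin|jout].
      have := no_in _ jin; have := insP _ jin; rewrite eil; clear - bl ab; lia.
    have := no_out _ jout; have : 0 < j <= l.
      move: jout; rewrite mem_outs => /andP[E0j ->]; rewrite andbT lt0n.
      by apply: contraTneq E0j => ->; apply: E_irr.
    by clear - bl ab; lia.
  have := size_ins0; have := size_outs0 eil.
  by rewrite !size_cat !size_iota; lia.
have sQ := size_outsl_cycle lti.
have QP q : q \in [seq q <- outs l | q <= i] -> E l q /\ q <= i.
  by rewrite mem_filter mem_outs => /and3P[].
have [|q /QP[_]||| q [q' [/QP[Elq qi] /QP[Elq' q'i] h1 h2]]] :=
    @exists_far_pair a i.+1 [seq q <- outs l | q <= i].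
- by rewrite filter_uniq // indices_uniq.
- by rewrite ltnS.
- by lia.
- by lia.
have qq' : q <= q' <= i by lia.
(* Both arcs have at least [a] vertices, and as the cycle has at least
   [2 * b] vertices, one of them has at least [b]. *)
have [h|h] := leqP b (q + i.+1 - q').
  by apply: (spider_lollipop Ei0 lti Elq Elq' qq'); lia.
by apply: spider_sym; apply: (spider_lollipop Ei0 lti Elq Elq' qq'); lia.
Qed.

End Degrees.

End IndexLists.

End LongestPaths.

(** * The theorem *)

Theorem spider_of_semidegree (V : finType) (e : rel V) (d a b : nat) :
  0 < #|V| -> (forall x y, e x y -> ~~ e y x) ->
  (forall v, d <= #|[set w | e v w]|) -> (forall v, d <= #|[set w | e w v]|) ->
  0 < a -> 0 < b -> 3 * (a + b) <= 4 * d -> spider e a b.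
Proof.
move=> V_gt0 asym od id a_gt0 b_gt0 abd.
wlog ab : a b a_gt0 b_gt0 abd / a <= b.
  move=> th; case: (leqP a b) => [|/ltnW] h; first exact: th.
  by apply: spider_sym; apply: th; rewrite // addnC.
have [x0 _] := card_gt0P V_gt0.
have [|p [i [p_longest p_closes i_max]]] := @longest_max_closing V e x0.
  by move=> v; apply: leq_trans (id v); lia.
have p_size : size p = (size p).-1.+1.
  by rewrite prednK //; case/andP: p_closes; case: size.
exact: (@spider_of_closing V e x0 p _ p_longest p_size d i).
Qed.

(** Listing the first branch backwards, then the centre, then the second
    branch enumerates the path in the order [p_0, ..., p_k], with the centre
    at position [a]. *)
Lemma spider_enum (V : finType) (e : rel V) (a b : nat) (x0 : V) :
  spider e a b ->
  exists z : seq V, [/\ size z = (a + b).+1, uniq z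
    & forall i j, i <= a + b -> j <= a + b ->
        ((j.+1 == i) && (j < a)) || ((i.+1 == j) && (a <= i)) ->
        e (nth x0 z i) (nth x0 z j)].
Proof.
case=> x [A [B [pA pB u sA sB]]]; exists (rev A ++ x :: B); split.
- by rewrite size_cat size_rev /= sA sB addnS.
- rewrite (@perm_uniq _ _ (x :: A ++ B)) //.
  by rewrite -cat1s perm_catCA perm_cons perm_cat2r perm_rev.
move=> i j ia ja /orP[]/andP[/eqP ij h]; rewrite -ij in ia ja *.
  have : sorted (fun y z => e z y) (rcons (rev A) x).
    by rewrite -rev_cons rev_sorted.
  move/(sortedP x0)/(_ j); rewrite size_rcons size_rev sA ltnS h => /(_ isT).
  by rewrite -cat_rcons !nth_cat size_rcons size_rev sA !ltnS h ltnW.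
have : sorted e (x :: B) by [].
move/(sortedP x0)/(_ (i - a)) => /=; rewrite ltnS sB => /(_ _) he.
rewrite !nth_cat size_rev sA !ltnNge h leqW //= subSn //.
by apply: he; lia.
Qed.

Lemma bigmin_le (T : finType) (N : nat) (F : T -> nat) (v : T) :
  \big[minn/N]_(w : T) F w <= F v.
Proof.
have : v \in index_enum T by rewrite mem_index_enum.
elim: (index_enum T) => // w s IH; rewrite inE big_cons => /orP[/eqP->|/IH h].
  exact: geq_minl.
exact: leq_trans (geq_minr _ _) h.
Qed.

Unset Implicit Arguments.

Theorem corollary1p3 (k : nat) (hk : 2 <= k) (G : digraph)
    (hG : oriented_graph G)
    (hdeg : ((3 * k)%:R / 4%:R <= (min_semidegree G)%:R :> rat)%R) :
  forall P : digraph, two_block_path k P -> contains G P.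
Proof.
have {}hdeg : 3 * k <= 4 * min_semidegree G.
  move: hdeg; rewrite Num.Theory.ler_pdivrMr //.
  by rewrite -GRing.natrM Num.Theory.ler_nat (mulnC _ 4).
have deg (v : G) : min_semidegree G <= minn (indeg v) (outdeg v).
  exact: (@bigmin_le G _ (fun v : G => minn (indeg v) (outdeg v))).
have asym (x y : G) : Defs.arc x y -> ~~ Defs.arc y x.
  by move=> xy; have := hG.2 x y; rewrite xy.
have inD (v : G) : min_semidegree G <= #|[set w | Defs.arc w v]|.
  exact: leq_trans (deg v) (geq_minl _ _).
have outD (v : G) : min_semidegree G <= #|[set w | Defs.arc v w]|.
  exact: leq_trans (deg v) (geq_minr _ _).
have [x0 _] := card_gt0P (vertex_gt0 G).
move=> P [p [r [[p' pK p'K] /andP[r_gt0 rk] arcs]]].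
have kE : r + (k - r) = k by lia.
(* Stated for arbitrary relations so as to apply also to the reversed arcs. *)
have embed (q : rel P) (e : rel G) : spider e r (k - r) ->
    (forall i j : 'I_k.+1, q (p i) (p j) ->
       ((j.+1 == i) && (j < r)) || ((i.+1 == j) && (r <= i))) ->
    exists f : P -> G, injective f /\ forall u v, q u v -> e (f u) (f v).
  case/(spider_enum x0)=> z [sz uz ez] hq; rewrite kE in sz ez.
  exists (fun v => nth x0 z (p' v)); split=> [u v /eqP|u v].
    rewrite nth_uniq ?sz ?ltn_ord // => /eqP/val_inj; exact: (can_inj p'K).
  rewrite -{1}[u]p'K -{1}[v]p'K => /hq h; apply: ez h; exact: leq_ord.
case: arcs => arcs.
  apply: (embed (@Defs.arc P) (@Defs.arc G)) => [|i j]; last by rewrite arcs.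
  by apply: (spider_of_semidegree _ asym outD inD); rewrite ?vertex_gt0 //; lia.
have [|i j|f [f_inj fP]] :=
    embed (fun u v => Defs.arc v u) (fun x y => Defs.arc y x).
- apply: (spider_of_semidegree _ _ inD outD); rewrite ?vertex_gt0 //; try lia.
  by move=> x y; apply: asym.
- by rewrite arcs orbC.
by exists f; split=> // u v; apply: fP.
Qed.
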